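(* Let $k$ be an arbitrary field, $R=k[x_1,\ldots,x_n]$, and let $F\subset R$ be a finite set of monomials of degree two having no non-trivial common factor and such that every variable $x_i$ divides at least one member of $F$. Let $\widetilde{\mathcal{G}}$ be the graph, possibly with loops, on the vertex set $\{x_1,\ldots,x_n\}$ whose edges and loops correspond bijectively to the pairs $\{x_i,x_j\}$ with $x_ix_j\in F$ (possibly $i=j$), and let $\mathcal{G}\subset\widetilde{\mathcal{G}}$ be the underlying simple graph obtained by omitting all loops. Let $A$ denote the incidence matrix of $\widetilde{\mathcal{G}}$, i.e. the log-matrix of $F$. Let $\mathbf{x}_2$ be the set of all monomials of degree $2$ in $R$. The following conditions are equivalent: (i) $F$ is cohesive and $A$ has maximal rank (i.e. $\mathrm{rank}(A)=n$). (ii) The extension $k[F]\subset k[\mathbf{x}_2]$ is birational. (iii) $\mathcal{G}$ is connected and, moreover, either it is non-bipartite or else it is bipartite and $\widetilde{\mathcal{G}}\setminus\mathcal{G}\neq\emptyset$ (i.e. $\widetilde{\mathcal{G}}$ has at least one loop).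
   Context: The log-matrix of a set of monomials $\{x^{v_1},\ldots,x^{v_q}\}$ is the $n\times q$ integer matrix whose columns are the exponent vectors $v_j$; thus a loop at $x_i$ contributes the column $2e_i$ and an edge $x_ix_j$ the column $e_i+e_j$. Rank is over $\mathbb{Q}$. A set $F$ of forms of fixed degree $\geq 2$ is cohesive if the forms have no non-trivial common factor and there is no partition $\mathbf{x}=\mathbf{y}\cup\mathbf{z}$ of the set of variables together with a decomposition $F=G\cup H$, with $G$ and $H$ both nonempty, such that the forms in $G$ involve only the $\mathbf{y}$-variables and the forms in $H$ involve only the $\mathbf{z}$-variables. $k[F]$ denotes the $k$-subalgebra of $R$ generated by $F$. An extension $D'\subset D$ of integral domains is birational if $D'$ and $D$ have the same field of fractions. *)

(* Defs.v *)
From HB Require Import structures.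
From mathcomp Require Import all_boot all_order all_algebra.
From mathcomp Require Import finmap.
From mathcomp.multinomials Require Import mpoly.

Set Implicit Arguments.
Unset Strict Implicit.
Unset Printing Implicit Defensive.

Import GRing.Theory.
Local Open Scope ring_scope.

(* Subsets of a ring are Prop-valued predicates: membership in a generated
   subalgebra is not decidable over an arbitrary field. *)

Inductive subalg_gen (k : comNzRingType) (A : algType k) (S : A -> Prop) :
  A -> Prop :=
| SubalgGenIn a : S a -> subalg_gen S a
| SubalgGenScalar (c : k) : subalg_gen S c%:A
| SubalgGenAdd a b :
    subalg_gen S a -> subalg_gen S b -> subalg_gen S (a + b)
| SubalgGenMul a b :
    subalg_gen S a -> subalg_gen S b -> subalg_gen S (a * b).

(* The field of fractions of a subring D of the domain A, realized as a
   subfield of the field of fractions of A. *)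
Definition frac_field (A : idomainType) (D : A -> Prop) (z : {fraction A}) :
  Prop :=
  exists a b : A, [/\ D a, D b, b != 0 & z = tofrac a / tofrac b].

Definition birational (A : idomainType) (D' D : A -> Prop) : Prop :=
  (forall a, D' a -> D a) /\ (forall z, frac_field D' z <-> frac_field D z).

Section Forms.
Variables (k : fieldType) (n : nat).
Implicit Types (f g : {mpoly k[n]}) (F : {mpoly k[n]} -> Prop).

Definition monomials (M : {pred 'X_{1..n}}) : {mpoly k[n]} -> Prop :=
  fun f => exists2 m, m \in M & f = 'X_[m].

(* The units of k[x_1, .., x_n] are the nonzero constants. *)
Definition no_common_factor F : Prop :=
  forall g, (forall f, F f -> exists q, f = q * g) -> g \is a GRing.unit.

Definition involves_only (Y : {set 'I_n}) f : Prop :=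
  forall (m : 'X_{1..n}) (i : 'I_n), m \in msupp f -> m i != 0%N -> i \in Y.

(* Intended for sets F of forms of a fixed degree at least 2. *)
Definition cohesive F : Prop :=
  no_common_factor F /\
  ~ exists (Y Z : {set 'I_n}) (G H : {mpoly k[n]} -> Prop),
      [/\ [/\ Y :|: Z = [set: 'I_n], [disjoint Y & Z], Y != set0 & Z != set0],
          forall f, F f <-> G f \/ H f,
          (exists g, G g) /\ (exists h, H h),
          forall g, G g -> involves_only Y g
        & forall h, H h -> involves_only Z h].

End Forms.

Arguments monomials k {n} M.

Section MonomialsOfDegreeTwo.
Variable n : nat.
Implicit Type M : {fset 'X_{1..n}}.

(* The columns are the exponent vectors of the monomials of M, listed without
   repetition; their order is irrelevant for the rank. *)
Definition log_matrix M : 'M[int]_(n, #|` M|) :=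
  \matrix_(i < n, j < #|` M|) (nth 0%MM (enum_fset M) j i)%:Z.

Definition loop_graph M : rel 'I_n := fun i j => (U_(i) + U_(j))%MM \in M.

Definition simple_graph M : rel 'I_n :=
  fun i j => (i != j) && loop_graph M i j.

End MonomialsOfDegreeTwo.

Definition connected (T : finType) (e : rel T) : bool :=
  (0 < #|T|)%N && [forall x, forall y, connect e x y].

Definition bipartite (T : finType) (e : rel T) : bool :=
  [exists S : {set T}, forall x, forall y,
    e x y ==> ((x \in S) != (y \in S))].

(* Main.v *)
(** Condition (iii) says that the simple graph is connected and that the graph
    with loops is not bipartite, i.e. that the bipartite double cover of the
    graph with loops is connected: any two vertices are joined by an odd walk.
    Multiplying and dividing alternately along an odd walk from i to j writes
    x_i x_j as a quotient of products of members of F, whence (ii); in the same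
    way a vector w with w_i + w_j = 0 on all edges satisfies w_i = - w_i, so the
    rows of the log-matrix are independent, whence (i).

    Conversely, let w be a weight on the variables, with values in any abelian
    group, such that w_i + w_j = 0 on all edges. Then k[F] has weight zero, so a
    monomial in its field of fractions has weight zero too. Applied to the
    indicator of a component with values in Z/2, and to the weights +1 and -1 on
    the sides of a bipartition with values in Z, this shows that (ii) forces the
    graph to be connected and not bipartite. The latter weight is also a nonzero
    left kernel vector of the log-matrix. *)

Require Import Defs.
From mathcomp Require Import all_boot all_order all_algebra.
From mathcomp Require Import finmap.
From mathcomp.multinomials Require Import mpoly.

Set Implicit Arguments.
Unset Strict Implicit.

Import GRing.Theory Num.Theory.
Local Open Scope ring_scope.

(** * Walks and the bipartite double cover *)

Lemma connect_ind (T : finType) (e : rel T) (P : T -> Prop) :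
  (forall x y, e x y -> P x -> P y) ->
  forall x y, connect e x y -> P x -> P y.
Proof.
move=> Pe x _ /connectP[p + ->]; elim: p x => //= z p IHp x /andP[exz pz] Px.
exact: IHp pz (Pe _ _ exz Px).
Qed.

Section DoubleCover.
Variables (T : finType) (e : rel T).
Hypothesis e_sym : ssrbool.symmetric e.

(** The tensor product of the graph with a single edge. Walks from [(x, b)] to [(y, c)] project to
    walks from [x] to [y], of even length if [b = c] and odd otherwise. *)
Definition double_cover : rel (T * bool) :=
  fun u v => e u.1 v.1 && (u.2 != v.2).

Lemma double_cover_connect_sym : connect_sym double_cover.
Proof. by apply: sym_connect_sym => u v; rewrite /double_cover e_sym eq_sym. Qed.

(** Exchanging the two sheets is an automorphism of the cover. *)
Lemma connect_double_cover_flip x y b c :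
  connect double_cover (x, b) (y, c) -> connect double_cover (x, ~~ b) (y, ~~ c).
Proof.
move=> xy; apply: (@connect_ind _ double_cover
  (fun u => connect double_cover (x, ~~ b) (u.1, ~~ u.2)) _ _ _ xy) => //=.
move=> u v /andP[euv neq_uv] /connect_trans; apply; apply: connect1.
by rewrite /double_cover /= euv (inj_eq negb_inj).
Qed.

(* An edge violating the bipartition by parity joins the two sheets over one
   vertex; translating by the flip joins them over every vertex. *)
Lemma connect_double_cover :
  (forall x y, connect e x y) -> ~~ bipartite e ->
  forall u v, connect double_cover u v.
Proof.
move=> e_conn /existsPn /= nbip.
have reach x y : exists b, connect double_cover (x, true) (y, b).
  apply: (@connect_ind _ e
    (fun z => exists b, connect double_cover (x, true) (z, b)) _ x) => //.
    move=> z t ezt [b xz]; exists (~~ b); apply: connect_trans xz _.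
    by apply: connect1; rewrite /double_cover ezt /=; case: (b).
  by exists true.
have turn x : connect double_cover (x, true) (x, false).
  (* The vertices reached from [x] by even walks. Some edge [i j] has both ends in [S] or both
     outside; the second case is impossible, since [i] outside [S] is reached by an odd walk, which
     the edge extends to an even walk to [j]. *)
  set S := [set i | connect double_cover (x, true) (i, true)].
  have /forallPn[i /forallPn[j]] := nbip S.
  rewrite negb_imply negbK => /andP[eij /eqP Sij].
  have step b : double_cover (i, b) (j, ~~ b) by rewrite /double_cover eij; case: (b).
  have Sj : j \in S.
    rewrite -[j \in S]orbb -{1}Sij; apply/orP.
    have [[] xi] := reach x i; first by left; rewrite inE.
    by right; rewrite inE (connect_trans xi) // connect1 // (step false).
  have xjt : connect double_cover (x, true) (j, true) by rewrite inE in Sj.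
  have xjf : connect double_cover (x, true) (j, false).
    rewrite -Sij inE in Sj; apply: connect_trans Sj _.
    exact/connect1/(step true).
  apply: connect_trans xjt _; rewrite double_cover_connect_sym.
  exact: connect_double_cover_flip xjf.
have turnb x b c : connect double_cover (x, b) (x, c).
  case: b c => [] [] //; last rewrite double_cover_connect_sym; exact: turn.
move=> [x b] [y c]; have [d xy] := reach x y.
by apply: connect_trans (turnb x b true) (connect_trans xy (turnb y d c)).
Qed.

End DoubleCover.

(** * Fields of fractions of subrings *)

Section FracField.
Variables (A : idomainType) (D : A -> Prop).
Hypotheses (D0 : D 0) (D1 : D 1).
Hypothesis DD : forall a b, D a -> D b -> D (a + b).
Hypothesis DM : forall a b, D a -> D b -> D (a * b).

Lemma frac_field_tofrac a : D a -> frac_field D (tofrac a).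
Proof. by exists a, 1; split; rewrite ?oner_eq0 // tofrac1 divr1. Qed.

Lemma frac_fieldD x y : frac_field D x -> frac_field D y -> frac_field D (x + y).
Proof.
move=> [a [b [Da Db b0 ->]]] [c [d [Dc Dd d0 ->]]].
exists (a * d + c * b), (b * d); split; rewrite ?mulf_neq0 //; auto.
by rewrite addf_div ?tofrac_eq0 // tofracD !tofracM.
Qed.

Lemma frac_fieldM x y : frac_field D x -> frac_field D y -> frac_field D (x * y).
Proof.
move=> [a [b [Da Db b0 ->]]] [c [d [Dc Dd d0 ->]]].
exists (a * c), (b * d); split; rewrite ?mulf_neq0 //; auto.
by rewrite mulf_div !tofracM.
Qed.

Lemma frac_fieldV x : frac_field D x -> frac_field D x^-1.
Proof.
move=> [a [b [Da Db b0 ->]]]; have [->|a0] := eqVneq a 0.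
  (* Here the convention that [0^-1] is [0] applies. *)
  by rewrite tofrac0 mul0r invr0 -tofrac0; exact: frac_field_tofrac.
by exists b, a; rewrite invf_div.
Qed.

Lemma frac_field_sub (E : A -> Prop) :
  (forall a, E a -> frac_field D (tofrac a)) ->
  forall z, frac_field E z -> frac_field D z.
Proof.
move=> ED _ [a [b [Ea Eb _ ->]]].
by apply: frac_fieldM; [exact: ED | apply: frac_fieldV; exact: ED].
Qed.

End FracField.

(** * Weights and monomials of degree two *)

Section Weights.
Variables (n : nat) (V : zmodType) (w : 'I_n -> V).

(** The degree of [m] in the [V]-grading that gives the variable [i] degree [w i]. *)
Definition weight (m : 'X_{1..n}) : V := \sum_i w i *+ m i.

Lemma weight0 : weight 0 = 0.
Proof. by apply: big1 => i _; rewrite mnm0E. Qed.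

Lemma weightD m1 m2 : weight (m1 + m2) = weight m1 + weight m2.
Proof.
by rewrite -big_split; apply: eq_bigr => i _; rewrite mnmDE mulrnDr.
Qed.

Lemma weightU i : weight U_(i) = w i.
Proof.
rewrite /weight (bigD1 i) //= mnm1E eqxx big1 ?addr0 // => j ne_ji.
by rewrite mnm1E eq_sym (negPf ne_ji).
Qed.

End Weights.

Lemma mdeg2_split n (m : 'X_{1..n}) i :
  mdeg m = 2%N -> m i != 0%N -> exists j, m = (U_(i) + U_(j))%MM.
Proof.
move=> m2 mi; have le_im : (U_(i) <= m)%MM by rewrite lep1mP.
have eq_m := submK le_im.
have /eqP/mdeg1P[j /eqP mj] : mdeg (m - U_(i))%MM = 1%N.
  by move: m2; rewrite -{1}eq_m mdegD mdeg1 addn1 => -[].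
by exists j; rewrite -eq_m mj addmC.
Qed.

Lemma mdeg2P n (m : 'X_{1..n}) :
  mdeg m = 2%N -> exists i j, m = (U_(i) + U_(j))%MM.
Proof.
move=> m2; have [i mi|m0] := pickP (fun i => m i != 0%N).
  by exists i; exact: mdeg2_split.
by move: m2; rewrite mdegE big1 // => i _; apply/eqP/negbFE/m0.
Qed.

(** * Birationality of generated subalgebras *)

Section Subalgebra.
Variables (k : fieldType) (n : nat).
Implicit Types (S : {mpoly k[n]} -> Prop) (M : {pred 'X_{1..n}}).

Lemma subalg_gen0 S : subalg_gen S 0.
Proof. by rewrite -(scale0r 1); exact: SubalgGenScalar. Qed.

Lemma subalg_gen1 S : subalg_gen S 1.
Proof. by rewrite -(scale1r 1); exact: SubalgGenScalar. Qed.

Lemma frac_subalgD S x y :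
  frac_field (subalg_gen S) x -> frac_field (subalg_gen S) y ->
  frac_field (subalg_gen S) (x + y).
Proof.
exact: (frac_fieldD (@SubalgGenAdd _ _ S) (@SubalgGenMul _ _ S)).
Qed.

Lemma frac_subalgM S x y :
  frac_field (subalg_gen S) x -> frac_field (subalg_gen S) y ->
  frac_field (subalg_gen S) (x * y).
Proof. by apply: frac_fieldM => a b; exact: SubalgGenMul. Qed.

Lemma frac_subalgV S x :
  frac_field (subalg_gen S) x -> frac_field (subalg_gen S) x^-1.
Proof. exact: frac_fieldV (subalg_gen0 S) (subalg_gen1 S) x. Qed.

Lemma frac_subalg_tofrac S a :
  subalg_gen S a -> frac_field (subalg_gen S) (tofrac a).
Proof. exact: frac_field_tofrac (subalg_gen1 S) a. Qed.

(** The fractions of the smaller algebra form a field containing the scalars, so it suffices to test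
    the generators of the larger one. *)
Lemma birational_subalg S S' :
  (forall a, S' a -> S a) ->
  birational (subalg_gen S') (subalg_gen S) <->
  (forall a, S a -> frac_field (subalg_gen S') (tofrac a)).
Proof.
move=> S'S; have sub a : subalg_gen S' a -> subalg_gen S a.
  elim=> {a} [a /S'S|c|a b _ + _|a b _ + _]; first exact: SubalgGenIn.
  - exact: SubalgGenScalar.
  - exact: SubalgGenAdd.
  - exact: SubalgGenMul.
split=> [[_ eq_frac] a Sa|gen].
  by apply/eq_frac/frac_subalg_tofrac/SubalgGenIn.
split=> // z; split.
  by move=> [a [b [/sub Sa /sub Sb b0 ->]]]; exists a, b.
apply: frac_field_sub; try exact: SubalgGenMul.
- exact: subalg_gen0.
- exact: subalg_gen1.
move=> a; elim=> {a} [a /gen //|c|a b _ Da _ Db|a b _ Da _ Db].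
- by apply: frac_subalg_tofrac; exact: SubalgGenScalar.
- by rewrite tofracD; exact: frac_subalgD.
- by rewrite tofracM; exact: frac_subalgM.
Qed.

(** Clearing the denominator gives an identity ['X_[m] * b = a] in which [a] and [b] have only
    monomials of weight zero; compare supports. *)
Lemma frac_monomials_weight (V : zmodType) (w : 'I_n -> V) M m :
  {in M, forall m', weight w m' = 0} ->
  frac_field (subalg_gen (monomials k M)) (tofrac 'X_[m]) -> weight w m = 0.
Proof.
move=> wM [a [b [Da Db b0 /eqP]]].
have supp0 p : subalg_gen (monomials k M) p ->
    forall m', m' \in msupp p -> weight w m' = 0.
  elim=> {p} [_ [m1 /wM w1 ->] m'|c m'|p q _ wp _ wq m'|p q _ wp _ wq m'].
  - by rewrite msuppX mem_seq1 => /eqP->.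
  - rewrite alg_mpolyC msuppC; case: eqP => // _.
    by rewrite mem_seq1 => /eqP->; exact: weight0.
  - by move/msuppD_le; rewrite mem_cat => /orP[/wp|/wq].
  - move/msuppM_le => /allpairsP[[m1 m2] /= [/wp w1 /wq w2 ->]].
    by rewrite weightD w1 w2 addr0.
have X0 : tofrac b != 0 by rewrite tofrac_eq0.
move=> /eqP/(congr1 ( *%R^~ (tofrac b))); rewrite divfK // -tofracM => /eqP.
rewrite tofrac_eq => /eqP eq_a.
case supp_b: (msupp b) b0 => [|m1 s]; first by rewrite (msuppnil0 supp_b) eqxx.
have m1b : m1 \in msupp b by rewrite supp_b mem_head.
(* Multiplication by ['X_[m]] translates the support, so no term cancels. *)
have m1a : (m + m1)%MM \in msupp a.
  by rewrite mcoeff_msupp -eq_a mulrC mcoeffMX -mcoeff_msupp.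
by have := supp0 _ Da _ m1a; rewrite weightD (supp0 _ Db _ m1b) addr0.
Qed.

End Subalgebra.

(** * Graph, log-matrix and quotients of edge monomials *)

Section LoopGraph.
Variables (n : nat) (M : {fset 'X_{1..n}}).
Hypothesis M2 : forall m, m \in M -> mdeg m = 2%N.

Lemma loop_graph_sym : ssrbool.symmetric (loop_graph M).
Proof. by move=> i j; rewrite /loop_graph addmC. Qed.

Lemma simple_graph_sym : ssrbool.symmetric (simple_graph M).
Proof. by move=> i j; rewrite /simple_graph eq_sym loop_graph_sym. Qed.

Lemma simple_graph_connect i j :
  loop_graph M i j -> connect (simple_graph M) i j.
Proof.
by have [->|ne_ij] := eqVneq i j => // eij; rewrite connect1 // /simple_graph ne_ij.
Qed.

(** A loop defeats every two-colouring, and the other edges are those of the simple graph. This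
    merges the two alternatives of (iii) into one. *)
Lemma bipartite_loop_graph :
  bipartite (loop_graph M) <->
  bipartite (simple_graph M) /\ ~ exists i, loop_graph M i i.
Proof.
split=> [/existsP[S /forallP bip]|[/existsP[S /forallP bip] noloop]].
  split=> [|[i Mii]]; last by move/forallP: (bip i) => /(_ i); rewrite Mii eqxx.
  apply/existsP; exists S; apply/forallP => i; apply/forallP => j.
  by apply/implyP => /andP[_ eij]; move/forallP: (bip i) => /(_ j); rewrite eij.
apply/existsP; exists S; apply/forallP => i; apply/forallP => j.
apply/implyP => eij; move/forallP: (bip i) => /(_ j); rewrite /simple_graph eij.
by case: eqP => // eq_ij _; case: noloop; exists i; rewrite {2}eq_ij.
Qed.

Lemma weight_loop_graphP (V : zmodType) (w : 'I_n -> V) :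
  (forall m, m \in M -> weight w m = 0) <->
  (forall i j, loop_graph M i j -> w i + w j = 0).
Proof.
split=> [wM i j /wM|we m Mm]; first by rewrite weightD !weightU.
have [i [j eq_m]] := mdeg2P (M2 Mm).
by rewrite eq_m weightD !weightU we // /loop_graph -eq_m.
Qed.

(** The entries of the product are the weights of the columns, and the columns enumerate [M]. *)
Lemma log_matrix_kernel (w : 'rV[rat]_n) :
  w *m map_mx intr (log_matrix M) = 0 <->
  (forall m, m \in M -> weight (w 0) m = 0).
Proof.
have entry j : (w *m map_mx intr (log_matrix M)) 0 j =
    weight (w 0) (nth 0%MM (enum_fset M) j).
  by rewrite mxE; apply: eq_bigr => i _; rewrite !mxE mulr_natr.
split=> [w0 m Mm|wM]; last first.
  by apply/rowP => j; rewrite entry mxE wM // mem_nth.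
have lt_m : (index m (enum_fset M) < #|` M|)%N by rewrite index_mem.
by have := entry (Ordinal lt_m); rewrite w0 mxE /= nth_index.
Qed.

Hypothesis conn : forall i j, connect (simple_graph M) i j.
Hypothesis nbip : ~~ bipartite (loop_graph M).

Lemma loop_graph_double_cover u v : connect (double_cover (loop_graph M)) u v.
Proof.
apply: connect_double_cover => //; first exact: loop_graph_sym.
move=> i j; apply: connect_sub (conn i j) => x y /andP[_]; exact: connect1.
Qed.

Lemma log_matrix_row_free : row_free (map_mx intr (log_matrix M) : 'M[rat]_(n, _)).
Proof.
apply: inj_row_free => w /log_matrix_kernel/weight_loop_graphP we.
apply/rowP => i; rewrite mxE.
suff: w 0 i = - w 0 i by move/eqP; rewrite -addr_eq0 -mulr2n mulrn_eq0 => /eqP.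
(* Each edge changes the sign of [w], so the sheet records the sign; an odd closed walk at [i]
   returns with the opposite one. *)
apply: (connect_ind (P := fun u => w 0 u.1 = if u.2 then w 0 i else - w 0 i) _
  (loop_graph_double_cover (i, true) (i, false))) => //.
move=> [j b] [l c] /andP[/= /we/eqP]; rewrite addrC addr_eq0 => /eqP-> + ->.
by case: b c => [] [] //; rewrite opprK.
Qed.

Lemma frac_edge_subalg (k : fieldType) i j :
  frac_field (subalg_gen (monomials k (mem M))) (tofrac 'X_[U_(i) + U_(j)]).
Proof.
pose x l : {fraction {mpoly k[n]}} := tofrac 'X_l.
have x0 l : x l != 0 by rewrite tofrac_eq0 -msupp_eq0 msuppX.
rewrite mpolyXD tofracM.
(* An edge [l m] turns [x i / x l] into [x i * x m] by multiplication by [x l * x m], and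
   [x i * x l] into [x i / x m] by division. The walk starts at [x i / x i = 1]. *)
pose P (u : 'I_n * bool) := frac_field (subalg_gen (monomials k (mem M)))
  (if u.2 then x i / x u.1 else x i * x u.1).
apply: (connect_ind (P := P) _
  (loop_graph_double_cover (i, true) (j, false))); last first.
  by rewrite /P /= divff // -tofrac1; apply/frac_subalg_tofrac/subalg_gen1.
move=> [l b] [m c] /andP[/= elm neq_bc].
have Plm : frac_field (subalg_gen (monomials k (mem M))) (x l * x m).
  rewrite -tofracM -mpolyXD; apply/frac_subalg_tofrac/SubalgGenIn.
  by exists (U_(l) + U_(m))%MM.
rewrite /P /=; case: b c neq_bc => [] [] //= _ Pil.
  by have := frac_subalgM Pil Plm; rewrite mulrA divfK.
by have := frac_subalgM Pil (frac_subalgV Plm); rewrite invfM mulrA mulfK.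
Qed.

End LoopGraph.

(** * Cohesion and connectedness *)

(** A forbidden partition of the variables is one that no edge crosses, that is, a splitting into
    unions of components. *)
Lemma cohesive_connected (k : fieldType) n (M : {fset 'X_{1..n}})
    (M2 : forall m, m \in M -> mdeg m = 2%N)
    (Mvar : forall i, exists2 m : 'X_{1..n}, m \in M & m i != 0%N) :
  no_common_factor (monomials k (mem M)) ->
  cohesive (monomials k (mem M)) <->
  (forall i j, connect (simple_graph M) i j).
Proof.
have UE (a b i : 'I_n) : ((U_(a) + U_(b))%MM i != 0%N) = (i == a) || (i == b).
  by rewrite mnmDE !mnm1E addn_eq0 !eqb0 negb_and !negbK !(eq_sym i).
move=> hgcd; split=> [[_ ncoh] i j|conn]; last first.
  split=> // -[Y [Z [G [H [[YZ dYZ /set0Pn[y Yy] /set0Pn[z Zz]] FE _ GY HZ]]]]].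
  have: z \in Y.
    (* An edge from [a] in [Y] gives a monomial in [G] or [H]; membership in [H] would put [a] in
       [Z], so the other end is in [Y] too. *)
    apply: (connect_ind (P := fun x => x \in Y) _ (conn y z)) => // a b /andP[_ eab] Ya.
    have Fab : monomials k (mem M) 'X_[U_(a) + U_(b)] by exists (U_(a) + U_(b))%MM.
    have supp : (U_(a) + U_(b))%MM \in msupp ('X_[U_(a) + U_(b)] : {mpoly k[n]}).
      by rewrite msuppX mem_head.
    have [/GY/(_ _ b supp)|/HZ/(_ _ a supp)] := (FE _).1 Fab; rewrite UE eqxx ?orbT.
      exact.
    by move=> /(_ isT) Za; rewrite (disjointFr dYZ Ya) in Za.
  by move=> Yz; rewrite (disjointFr dYZ Yz) in Zz.
apply/negPn/negP => not_ij; apply: ncoh.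
(* The component of [i] and its complement, which contains [j], split the variables. Both classes of
   forms are nonempty because every variable divides a member of [M]. *)
pose Y := [set a | connect (simple_graph M) i a].
have Yedge a b : loop_graph M a b -> (a \in Y) = (b \in Y).
  move=> eab; rewrite !inE.
  exact: (same_connect_r (sym_connect_sym (@simple_graph_sym n M))
            (simple_graph_connect eab)).
pose F (W : {set 'I_n}) (f : {mpoly k[n]}) :=
  exists a b, [/\ loop_graph M a b, a \in W, b \in W & f = 'X_[U_(a) + U_(b)]].
have F_only W f : F W f -> involves_only W f.
  move=> [a [b [_ Wa Wb ->]]] m l; rewrite msuppX mem_seq1 => /eqP->.
  by rewrite UE => /orP[] /eqP->.
have F_ex (W : {set 'I_n}) a : (forall c d, loop_graph M c d -> (c \in W) = (d \in W)) ->
    a \in W -> exists f, F W f.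
  move=> Wedge Wa; have [m Mm ma] := Mvar a.
  have [b eq_m] := mdeg2_split (M2 _ Mm) ma.
  have eab : loop_graph M a b by rewrite /loop_graph -eq_m.
  by exists 'X_[U_(a) + U_(b)], a, b; split; rewrite // -(Wedge _ _ eab).
have Yi : i \in Y by rewrite inE connect0.
have Zj : j \in ~: Y by rewrite !inE.
have Zedge a b : loop_graph M a b -> (a \in ~: Y) = (b \in ~: Y).
  by move=> /Yedge eab; rewrite !in_setC eab.
exists Y, (~: Y), (F Y), (F (~: Y)); split.
- split; first exact: setUCr.
  + by rewrite -setI_eq0 setICr.
  + by apply/set0Pn; exists i.
  + by apply/set0Pn; exists j.
- move=> f; split=> [[m Mm ->]|].
    have [a [b eq_m]] := mdeg2P (M2 _ Mm); rewrite eq_m in Mm *.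
    have Yab := Yedge a b Mm; have Zab := Zedge a b Mm.
    have [Ya|Za] := boolP (a \in Y); [left | right]; exists a, b.
      by split; rewrite // -Yab.
    by split; rewrite // -?Zab in_setC.
  by case=> -[a [b [eab _ _ ->]]]; exists (U_(a) + U_(b))%MM.
- by split; [exact: F_ex Yedge Yi | exact: F_ex Zedge Zj].
- exact: F_only.
- exact: F_only.
Qed.

(** Without variables there are no monomials of degree two, so [0] is vacuously a common factor, and
    it is not a unit. *)
Lemma no_common_factor_dim_gt0 (k : fieldType) n (M : {fset 'X_{1..n}}) :
  (forall m, m \in M -> mdeg m = 2%N) ->
  no_common_factor (monomials k (mem M)) -> (0 < n)%N.
Proof.
case: n M => // M M2 gcd; suff: (0 : {mpoly k[0]}) \is a GRing.unit by rewrite unitr0.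
by apply: gcd => f [m /M2]; rewrite mdegE big_ord0.
Qed.

(** Opposite signs on the two sides. The ring is left general, to serve over [rat] as a kernel
    vector and over [int] as a grading. *)
Lemma bipartite_weight (R : pzRingType) n (M : {fset 'X_{1..n}}) :
  bipartite (loop_graph M) ->
  exists w : 'I_n -> R, (forall i, w i = 1 \/ w i = -1) /\
    forall i j, loop_graph M i j -> w i + w j = 0.
Proof.
move=> /existsP[S /forallP bip]; exists (fun i => if i \in S then 1 else -1).
split=> [i|i j eij]; first by case: ifP; auto.
move/forallP: (bip i) => /(_ j); rewrite eij /=.
by case: (i \in S) (j \in S) => [] [] //; rewrite ?subrr ?addNr.
Qed.

Lemma row_free_nonbipartite n (M : {fset 'X_{1..n}}) :
  (0 < n)%N -> (forall m, m \in M -> mdeg m = 2%N) ->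
  row_free (map_mx intr (log_matrix M) : 'M[rat]_(n, _)) ->
  ~~ bipartite (loop_graph M).
Proof.
move=> n0 M2 free; apply/negP => /(@bipartite_weight rat)[w [w1 we]].
have /log_matrix_kernel/eqP :
    forall m, m \in M -> weight ((\row_i w i) 0) m = 0.
  by apply/weight_loop_graphP => // i j /we; rewrite !mxE.
rewrite mulmx_free_eq0 // => /eqP/rowP/(_ (Ordinal n0)); rewrite !mxE.
by case: (w1 (Ordinal n0)) => ->; move/eqP; rewrite ?oppr_eq0 oner_eq0.
Qed.

(** All products of two variables, squares included, become fractions of the smaller algebra, hence
    have weight zero. *)
Lemma birational_weight (k : fieldType) n (M : {fset 'X_{1..n}})
    (V : zmodType) (w : 'I_n -> V) :
  (forall m, m \in M -> mdeg m = 2%N) ->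
  birational (subalg_gen (monomials k (mem M)))
    (subalg_gen (monomials k [pred m : 'X_{1..n} | mdeg m == 2%N])) ->
  (forall i j, loop_graph M i j -> w i + w j = 0) ->
  forall i j, w i + w j = 0.
Proof.
move=> M2 bir we i j.
rewrite -(weightU w i) -(weightU w j) -weightD.
apply: (@frac_monomials_weight k _ _ _ (mem M)); first exact/weight_loop_graphP.
move/birational_subalg: bir; apply; last first.
  by exists (U_(i) + U_(j))%MM; rewrite // inE mdegD !mdeg1.
by move=> _ [m Mm ->]; exists m; rewrite // inE M2.
Qed.


Theorem theorem4p7 (k : fieldType) (n : nat) (M : {fset 'X_{1..n}})
  (hdeg : forall m : 'X_{1..n}, m \in M -> mdeg m = 2%N)
  (hgcd : no_common_factor (monomials k (mem M)))
  (hvar : forall i : 'I_n, exists2 m : 'X_{1..n}, m \in M & m i != 0%N) :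
  let cond_i :=
    cohesive (monomials k (mem M)) /\
    \rank (map_mx intr (log_matrix M) : 'M[rat]_(n, #|` M|)) = n in
  let cond_ii :=
    birational
      (subalg_gen (monomials k (mem M)))
      (subalg_gen (monomials k [pred m : 'X_{1..n} | mdeg m == 2%N])) in
  let cond_iii :=
    connected (simple_graph M) /\
    (~~ bipartite (simple_graph M) \/
     bipartite (simple_graph M) /\ exists i : 'I_n, loop_graph M i i) in
  (cond_i <-> cond_ii) /\ (cond_ii <-> cond_iii).
Proof.
move=> cond_i cond_ii cond_iii.
have n0 := no_common_factor_dim_gt0 hdeg hgcd.
(* Each of the three conditions is compared with this one. *)
pose graph_cond := (forall i j, connect (simple_graph M) i j) /\
  ~~ bipartite (loop_graph M).
have iiiE : cond_iii <-> graph_cond.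
  rewrite /cond_iii /graph_cond /connected card_ord n0 /=.
  have bipE := bipartite_loop_graph M.
  split=> [[/forallP conn bip]|[conn nbip]]; split.
  - by move=> i j; exact: (forallP (conn i)).
  - by apply/negP => /bipE[bipS noloop]; case: bip => [/negP|[]].
  - by apply/forallP => i; apply/forallP => j.
  have [bipS|nbipS] := boolP (bipartite (simple_graph M)); [right | by left].
  split=> //; have [/existsP//|noloop] := boolP [exists i, loop_graph M i i].
  case/negP: nbip; apply/bipE; split=> // /existsP; exact/negP.
have iE : cond_i <-> graph_cond.
  rewrite /cond_i (cohesive_connected hdeg hvar hgcd); split=> -[conn H]; split=> //.
    by apply: row_free_nonbipartite => //; apply/eqP.
  exact/eqP/log_matrix_row_free.
have iiE : cond_ii <-> graph_cond.
  split=> [bir|[conn nbip]]; last first.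
    apply/birational_subalg => [_ [m Mm ->]|_ [m /eqP m2 ->]].
      by exists m; rewrite // inE hdeg.
    by have [i [j ->]] := mdeg2P m2; exact: frac_edge_subalg.
  split.
    move=> i j.
    (* The indicator of the component of [i] is constant along edges, so its sums over edges vanish
       modulo 2. At the pair [i], [j] the sum is [1 + w j], which forces [j] into the component. *)
    pose w l : 'F_2 := (connect (simple_graph M) i l)%:R.
    have dbl (b : bool) : b%:R + b%:R = 0 :> 'F_2 by case: b; apply: val_inj.
    have /(birational_weight hdeg bir)/(_ i j) :
        forall a b, loop_graph M a b -> w a + w b = 0.
      move=> a b /simple_graph_connect eab; rewrite /w.
      by rewrite (same_connect_r (sym_connect_sym (@simple_graph_sym n M)) eab) dbl.
    by rewrite /w connect0; case: connect.
  apply/negP => /(@bipartite_weight int)[w [w1 we]].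
  (* The square of one variable has weight 2 or -2, which is nonzero in [int]. *)
  have /= := birational_weight hdeg bir we (Ordinal n0) (Ordinal n0).
  by case: (w1 (Ordinal n0)) => ->.
by rewrite iE iiE iiiE.
Qed.
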